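(* Let $\mathcal{A}\in\mathbb{C}^{I_1\times\cdots\times I_N\times I_1\times\cdots\times I_N}$ be an invertible tensor such that $w(\mathcal{A})\le 1$ and $|\mathcal{A}|\ge\mathcal{I}$. Then $\mathcal{A}$ is unitary.
   Context: For tensors $\mathcal{A},\mathcal{B}\in\mathbb{C}^{I_1\times\cdots\times I_N\times I_1\times\cdots\times I_N}$ the Einstein product is $(\mathcal{A}*_N\mathcal{B})_{i_1\ldots i_Nj_1\ldots j_N}=\sum_{k_1,\ldots,k_N}a_{i_1\ldots i_Nk_1\ldots k_N}b_{k_1\ldots k_Nj_1\ldots j_N}$, and for $\mathcal{X}\in\mathbb{C}^{I_1\times\cdots\times I_N}$, $(\mathcal{A}*_N\mathcal{X})_{i_1\ldots i_N}=\sum_{k_1,\ldots,k_N}a_{i_1\ldots i_Nk_1\ldots k_N}x_{k_1\ldots k_N}$. The identity tensor $\mathcal{I}$ has entries $\prod_{r=1}^N\delta_{i_rj_r}$; $\mathcal{A}$ is invertible if it has a two-sided inverse under $*_N$. The conjugate transpose is $(\mathcal{A}^H)_{i_1\ldots i_Nj_1\ldots j_N}=\overline{a_{j_1\ldots j_Ni_1\ldots i_N}}$; $\mathcal{A}$ is unitary if $\mathcal{A}^H*_N\mathcal{A}=\mathcal{A}*_N\mathcal{A}^H=\mathcal{I}$. With $\langle\mathcal{X},\mathcal{Y}\rangle=\sum_{i_1,\ldots,i_N}x_{i_1\ldots i_N}\overline{y_{i_1\ldots i_N}}$ and $\|\mathcal{X}\|=\langle\mathcal{X},\mathcal{X}\rangle^{1/2}$,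 the numerical range is $W(\mathcal{A})=\{\langle\mathcal{A}*_N\mathcal{X},\mathcal{X}\rangle:\mathcal{X}\in\mathbb{C}^{I_1\times\cdots\times I_N},\|\mathcal{X}\|=1\}$ and the numerical radius is $w(\mathcal{A})=\max\{|z|:z\in W(\mathcal{A})\}$. A tensor $\mathcal{B}$ is positive semidefinite if $\mathcal{B}^H=\mathcal{B}$ and $\langle\mathcal{B}*_N\mathcal{X},\mathcal{X}\rangle\ge 0$ for all $\mathcal{X}$. $|\mathcal{A}|=(\mathcal{A}^H*_N\mathcal{A})^{1/2}$ is the positive semidefinite square root (with respect to $*_N$) of $\mathcal{A}^H*_N\mathcal{A}$, and $\mathcal{A}\ge\mathcal{B}$ means that $\mathcal{A}-\mathcal{B}$ is positive semidefinite. *)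

(* Defs.v *)
From HB Require Import structures.
From mathcomp Require Import all_boot all_order all_algebra.
From mathcomp Require Import complex.
From mathcomp Require Import boolp classical_sets reals.

Set Implicit Arguments.
Unset Strict Implicit.
Unset Printing Implicit Defensive.
Import Order.TTheory GRing.Theory Num.Theory.
Local Open Scope ring_scope.

Section Tensors.
Variables (R : realType) (N : nat) (I : 'I_N -> nat).

Definition mindex := {dffun forall r : 'I_N, 'I_(I r)}.

Definition tensor := {ffun mindex -> R[i]}.

(* Even-order tensors, indexed by (i_1 .. i_N, j_1 .. j_N). *)
Definition sqtensor := {ffun mindex * mindex -> R[i]}.

Definition einstein (A B : sqtensor) : sqtensor :=
  [ffun ij => \sum_(k : mindex) A (ij.1, k) * B (k, ij.2)].

Definition einstein_act (A : sqtensor) (X : tensor) : tensor :=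
  [ffun i => \sum_(k : mindex) A (i, k) * X k].

Definition idtensor : sqtensor :=
  [ffun ij : mindex * mindex =>
    \prod_(r < N) ((ij.1 : mindex) r == (ij.2 : mindex) r)%:R].

Definition invertible_tensor (A : sqtensor) : Prop :=
  exists B, einstein A B = idtensor /\ einstein B A = idtensor.

Definition ctranspose (A : sqtensor) : sqtensor :=
  [ffun ij => (A (ij.2, ij.1))^*].

Definition unitary_tensor (A : sqtensor) : Prop :=
  einstein (ctranspose A) A = idtensor /\ einstein A (ctranspose A) = idtensor.

Definition tdot (X Y : tensor) : R[i] := \sum_(i : mindex) X i * (Y i)^*.

Definition tnorm (X : tensor) : R[i] := sqrtC (tdot X X).

Definition numerical_range (A : sqtensor) : set R[i] :=
  [set z | exists2 X, tnorm X = 1 & z = tdot (einstein_act A X) X]%classic.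

(* The modulus on R[i] takes its (real) values in R[i], whence the Re.
   When every I r is positive, the numerical range is nonempty and compact,
   so that this supremum is a maximum. *)
Definition numerical_radius (A : sqtensor) : R :=
  sup [set complex.Re `|z| | z in numerical_range A]%classic.

(* For z : R[i], 0 <= z means that z is real and nonnegative. *)
Definition psd_tensor (B : sqtensor) : Prop :=
  ctranspose B = B /\ forall X, 0 <= tdot (einstein_act B X) X.

Definition tensor_ge (A B : sqtensor) : Prop := psd_tensor (A - B).

(* The square root of a positive semidefinite tensor exists and is unique; the
   default 0 is only returned on tensors that are not positive semidefinite. *)
Definition tensor_sqrt (B : sqtensor) : sqtensor :=
  xget 0 [set P | psd_tensor P /\ einstein P P = B]%classic.

Definition tensor_abs (A : sqtensor) : sqtensor :=
  tensor_sqrt (einstein (ctranspose A) A).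

End Tensors.

Arguments idtensor {R N I}.

(* Main.v *)
(** With [|A| = I + Q], [Q >= 0], one gets
    [|A X|^2 = |X|^2 + 2 <Q X, X> + |Q X|^2 >= |X|^2], while [w(A) <= 1] gives
    [|<A X, X>| <= |X|^2]. Flatten [A] into a matrix and triangularize it by a
    unitary matrix (Schur). The diagonal entries [t] of the triangular form are
    eigenvalues, so [|t| = 1] by the two inequalities. Testing the second one on
    [e_i + y e_j] with a suitable small [y] forces the entry below the diagonal
    to vanish: the triangular form is diagonal with unimodular entries. *)
Require Import Defs.
From mathcomp Require Import all_boot all_order all_algebra.
From mathcomp Require Import spectral sesquilinear complex.
From mathcomp Require Import classical_sets.
From mathcomp Require Import reals.
From mathcomp Require Import ring.
Local Open Scope ring_scope.

Set Implicit Arguments.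
Unset Strict Implicit.
Unset Printing Implicit Defensive.
Import Order.TTheory GRing.Theory Num.Theory.

(** * Complex matrices: the two quadratic bounds force unitarity *)

Section NumericalRangeMatrix.
Local Open Scope sesquilinear_scope.
Variable C : numClosedFieldType.

Lemma dotmx_sumE n (u v : 'rV[C]_n) : dotmx u v = \sum_i u 0 i * (v 0 i)^*.
Proof. by rewrite dotmxE mxE; apply: eq_bigr => i _; rewrite !mxE. Qed.

Lemma dotmx_mull n m (u : 'rV[C]_m) (B : 'M[C]_(m, n)) (v : 'rV[C]_n) :
  dotmx (u *m B) v = dotmx u (v *m B^t*).
Proof. by rewrite !dotmxE trmx_mul map_mxM /= trmxCK mulmxA. Qed.

(** The term [y * c] is linear in [y], while the slack is only quadratic. Taking [y = a * c^* / 4]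
    aligns [y * c] with [a], so that [a + y * c] has modulus [1 + |c|^2 / 4]. Moving [|y|^2 * b] to
    the right bounds this by [1 + 2 |y|^2 = 1 + |c|^2 / 8], hence [c = 0]. *)
Lemma perturbed_unimodular_eq0 (a b c : C) : `|a| = 1 -> `|b| = 1 ->
  (forall y, `|a + y * c + `|y| ^+ 2 * b| <= 1 + `|y| ^+ 2) -> c = 0.
Proof.
move=> a1 b1 /(_ (a * c^* / 4%:R)) /=.
have four : `|4%:R : C| = 4%:R by rewrite normr_nat.
have -> : `|a * c^* / 4%:R| = `|c| / 4%:R.
  by rewrite !normrM normfV four a1 mul1r norm_conjC.
set d := (`|c| / 4%:R) ^+ 2; set z := a + _ => zle.
have d_ge0 : 0 <= d by rewrite exprn_ge0 // divr_ge0.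
have zE : z = a * (1 + `|c| ^+ 2 / 4%:R) by rewrite normCK /z; field.
have le2 : `|z| <= 1 + d + d.
  rewrite -[z](addrK (d * b)) (le_trans (ler_normB _ _)) // lerD //.
  by rewrite normrM b1 mulr1 ger0_norm.
move: le2; rewrite zE normrM a1 mul1r ger0_norm; last first.
  by rewrite addr_ge0 // divr_ge0 // exprn_ge0.
rewrite -addrA lerD2l -subr_ge0.
have -> : d + d - `|c| ^+ 2 / 4%:R = - (`|c| ^+ 2 / 8%:R) by rewrite /d; field.
rewrite oppr_ge0 pmulr_lle0 ?invr_gt0 ?ltr0n // => le0.
apply/eqP; rewrite -normr_eq0 -sqrf_eq0 eq_le le0 /=.
by rewrite exprn_ge0.
Qed.

Lemma diag_unitarymx n (T : 'M[C]_n) : (forall i, `|T i i| = 1) ->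
  (forall i j, i != j -> T i j = 0) -> T \is unitarymx.
Proof.
move=> T1 T0; apply/unitarymxP/matrixP => i j; rewrite !mxE (bigD1 i) //= !mxE.
rewrite big1 ?addr0 => [|k ki]; last by rewrite T0 1?eq_sym // mul0r.
have [<-|ij] := eqVneq i j; first by rewrite -normCK T1 expr1n.
by rewrite (T0 j i) 1?eq_sym // conjC0 mulr0.
Qed.

Section Bounds.
Variables (n : nat) (T : 'M[C]_n).
Hypothesis T_le : forall v : 'rV_n, `|dotmx (v *m T) v| <= dotmx v v.
Hypothesis T_ge : forall v : 'rV_n,
  dotmx v v <= dotmx (v *m T^t*) (v *m T^t*).

Let e i : 'rV[C]_n := delta_mx 0 i.

Lemma dotmx_delta_mul i j : dotmx (e i *m T) (e j) = T i j.
Proof.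
rewrite -rowE dotmx_sumE (bigD1 j) //= big1 ?addr0 => [|k kj].
  by rewrite !mxE !eqxx conjC1 mulr1.
by rewrite !mxE (negPf kj) andbF conjC0 mulr0.
Qed.

Lemma dotmx_delta i j : dotmx (e i) (e j) = (i == j)%:R.
Proof.
rewrite dotmx_sumE (bigD1 j) //= big1 ?addr0 => [|k kj].
  by rewrite !mxE !eqxx conjC1 mulr1 eq_sym.
by rewrite !mxE (negPf kj) andbF conjC0 mulr0.
Qed.

Lemma diag_norm_eq1 i : is_trig_mx T -> `|T i i| = 1.
Proof.
move=> /is_trig_mxP trigT.
have T1 : `|T i i| <= 1.
  by have := T_le (e i); rewrite dotmx_delta_mul dotmx_delta eqxx.
apply/eqP; rewrite eq_le T1 /=.
(* For the lower bound, [T_ge] needs a row eigenvector of [T^t*] for the conjugate of [T i i]; it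
   exists because the triangular [T - T i i] has a zero on its diagonal. *)
have : \det ((T - (T i i)%:M)^t*) = 0.
  rewrite det_map_mx det_tr det_trig; last first.
    by apply/is_trig_mxP => j k jk; rewrite !mxE trigT // -val_eqE ltn_eqF // subr0.
  by rewrite (bigD1 i) //= !mxE eqxx subrr mul0r rmorph0.
move/eqP/det0P => [u u0 uT].
have {}uT : u *m T^t* = (T i i)^* *: u.
  move/eqP: uT; rewrite linearB /= map_mxB mulmxBr subr_eq0 => /eqP ->.
  by rewrite tr_scalar_mx map_scalar_mx mul_mx_scalar.
have u_gt0 : 0 < dotmx u u by rewrite lt_def dnorm_eq0 u0 dnorm_ge0.
have := T_ge u; rewrite uT linearZl_LR linearZr_LR /= mulrA conjCK mulrC.
rewrite -ler_pdivrMl // mulVf ?gt_eqF // mulrC -normCK.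
by rewrite -[X in X <= _](expr1n _ 2) ler_sqr // ?nnegrE.
Qed.

Lemma trig_unitarymx : is_trig_mx T -> T \is unitarymx.
Proof.
move=> trigT; have T1 i := diag_norm_eq1 i trigT.
apply: diag_unitarymx => // i j; rewrite neq_lt => /orP[ij|ji].
  by move/is_trig_mxP: trigT; apply.
apply: (perturbed_unimodular_eq0 (T1 j) (T1 i)) => y.
have Tji : T j i = 0 by move/is_trig_mxP: trigT; apply.
have nij : (i == j) = false by rewrite -val_eqE gtn_eqF.
(* Here [j < i], so the [y^*] term of the expansion carries [T j i = 0]. What remains is
   [T j j + y * T i j + |y|^2 * T i i], bounded by [1 + |y|^2]. *)
have := T_le (e j + y *: e i).
rewrite mulmxDl -scalemxAl !linearDl !linearDr /= !linearZl_LR !linearZr_LR /=.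
rewrite !dotmx_delta_mul !dotmx_delta Tji !eqxx nij eq_sym nij.
by rewrite !(mulr0, addr0, add0r, mulr1) mulrA -normCK addrA.
Qed.

End Bounds.

Theorem numerical_range_unitarymx n (M : 'M[C]_n) :
  (forall v : 'rV_n, `|dotmx (v *m M) v| <= dotmx v v) ->
  (forall v : 'rV_n, dotmx v v <= dotmx (v *m M^t*) (v *m M^t*)) ->
  M \is unitarymx.
Proof.
(* [Schur] asks for a positive dimension. *)
case: n M => [|n] M M_le M_ge; first by apply/unitarymxP/matrixP => -[].
have [P Pu] := Schur M (ltn0Sn n).
rewrite /similar_to /= conjymx // => trigT.
have dotP (u v : 'rV_n.+1) : dotmx (u *m P) (v *m P) = dotmx u v.
  by rewrite dotmx_mull mulmxtVK.
(* Both bounds survive unitary conjugation: apply them to [v *m P], which has the norm of [v]. *)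
have Tu : P *m M *m P^t* \is unitarymx.
  apply: trig_unitarymx trigT => v.
    by rewrite !mulmxA dotmx_mull trmxCK -[X in _ <= X]dotP.
  rewrite !trmx_mul !map_mxM /= trmxCK !mulmxA -(dotP v).
  rewrite -(dotP (v *m P *m _ *m _)) mulmxKtV //.
have -> : M = P^t* *m (P *m M *m P^t*) *m P.
  rewrite -!mulmxA (mulmxA (P^t*) P) -invmx_unitary // mulVmx ?unitarymx_unit //.
  by rewrite mulmx1 mul1mx.
by apply: mul_unitarymx => //; apply: mul_unitarymx => //; rewrite trmxC_unitary.
Qed.

End NumericalRangeMatrix.

(** * Einstein product, inner product and numerical radius of tensors *)

Section TensorAlgebra.
Variables (R : realType) (N : nat) (I : 'I_N -> nat).
Implicit Types (A B P : sqtensor R I) (X Y Z : tensor R I).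

Lemma idtensorE (i j : mindex I) : idtensor (i, j) = (i == j)%:R :> R[i].
Proof.
rewrite ffunE /=; have [->|ij] := eqVneq i j.
  by rewrite big1 // => r _; rewrite eqxx.
have [r rij] : exists r, i r != j r.
  apply/existsP; apply: contraNT ij; rewrite negb_exists => /forallP ij.
  by apply/eqP/ffunP => r; apply/eqP; rewrite -[_ == _]negbK ij.
by rewrite (bigD1 r) //= (negPf rij) mul0r.
Qed.

Lemma einstein_act1 X : einstein_act idtensor X = X.
Proof.
apply/ffunP => i; rewrite ffunE (bigD1 i) //= big1 => [|k ki].
  by rewrite idtensorE eqxx mul1r addr0.
by rewrite idtensorE eq_sym (negPf ki) mul0r.
Qed.

Lemma einstein_actM A B X :
  einstein_act (einstein A B) X = einstein_act A (einstein_act B X).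
Proof.
apply/ffunP => i; rewrite !ffunE.
under eq_bigr do rewrite ffunE mulr_suml.
rewrite exchange_big /=; apply: eq_bigr => k _; rewrite ffunE mulr_sumr.
by apply: eq_bigr => l _; rewrite mulrA.
Qed.

Lemma einstein_actBl A B X :
  einstein_act (A - B) X = einstein_act A X - einstein_act B X.
Proof.
apply/ffunP => i; rewrite !ffunE -sumrB.
by apply: eq_bigr => k _; rewrite !ffunE mulrBl.
Qed.

Lemma tdot_adjoint A X Y :
  tdot (einstein_act A X) Y = tdot X (einstein_act (ctranspose A) Y).
Proof.
rewrite /tdot; under eq_bigr do rewrite ffunE mulr_suml.
rewrite exchange_big /=; apply: eq_bigr => k _; rewrite ffunE rmorph_sum mulr_sumr.
by apply: eq_bigr => i _; rewrite ffunE /= rmorphM /= conjCK; ring.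
Qed.

Lemma ctransposeK : involutive (@ctranspose R N I).
Proof. by move=> A; apply/ffunP => -[i j]; rewrite !ffunE conjCK. Qed.

Lemma tdotC X Y : tdot X Y = (tdot Y X)^*.
Proof.
rewrite /tdot rmorph_sum; apply: eq_bigr => i _.
by rewrite rmorphM /= conjCK mulrC.
Qed.

Lemma tdotDl X Y Z : tdot (X + Y) Z = tdot X Z + tdot Y Z.
Proof. by rewrite /tdot -big_split; apply: eq_bigr => i _; rewrite ffunE mulrDl. Qed.

Lemma tdotDr X Y Z : tdot X (Y + Z) = tdot X Y + tdot X Z.
Proof. by rewrite tdotC tdotDl rmorphD /= -!tdotC. Qed.

Lemma tdot_ge0 X : 0 <= tdot X X.
Proof. by apply: sumr_ge0 => i _; rewrite -normCK exprn_ge0. Qed.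

Lemma tdot_eq0 X : tdot X X = 0 -> X = 0.
Proof.
move/eqP; rewrite psumr_eq0 => [/allP X0|i _]; last by rewrite -normCK exprn_ge0.
apply/ffunP => i; have := X0 i (mem_index_enum i).
by rewrite -normCK sqrf_eq0 normr_eq0 ffunE => /eqP.
Qed.

Lemma tnorm1 X : tnorm X = 1 -> tdot X X = 1.
Proof. by move=> X1; rewrite -[LHS]sqrtCK -/(tnorm X) X1 expr1n. Qed.

(** A crude bound, enough for the supremum in [numerical_radius] to be an upper bound: the entries
    of a unit tensor have modulus at most 1. *)
Lemma numerical_range_bound A z : numerical_range A z ->
  `|z| <= \sum_i \sum_k `|A (i, k)|.
Proof.
case=> X /tnorm1 X1 ->; rewrite /tdot.
have Xle i : `|X i| <= 1.
  rewrite -(@expr_le1 _ 2) // -X1 /tdot (bigD1 i) //= -normCK lerDl sumr_ge0 // => k _.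
  by rewrite -normCK exprn_ge0.
rewrite (le_trans (ler_norm_sum _ _ _)) // ler_sum // => i _.
rewrite ffunE normrM norm_conjC (@le_trans _ _ `|\sum_k A (i, k) * X k|) //.
  by rewrite ler_piMr.
rewrite (le_trans (ler_norm_sum _ _ _)) // ler_sum // => k _.
by rewrite normrM ler_piMr.
Qed.

Lemma numerical_radius_ge A z : numerical_range A z ->
  `|z| <= (numerical_radius A)%:C%C.
Proof.
move=> Az; have normE (x : R[i]) : `|x| = (complex.Re `|x|)%:C%C.
  by rewrite normc_def.
rewrite normE lecR; apply: sup_upper_bound; last by exists z.
split; first by exists (complex.Re `|z|), z.
exists (complex.Re (\sum_i \sum_k `|A (i, k)|)) => _ [x Ax <-].
by have := numerical_range_bound Ax; rewrite lecE => /andP[].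
Qed.

(** Both sides are homogeneous of degree 2, so a nonzero [X] may be scaled to norm 1, where the form
    takes a value in the numerical range. *)
Lemma numerical_radius_tdot A X : numerical_radius A <= 1 ->
  `|tdot (einstein_act A X) X| <= tdot X X.
Proof.
move=> wA; have [X0|Xn0] := eqVneq (tdot X X) 0.
  rewrite X0 (tdot_eq0 X0) /tdot big1 ?normr0 // => i _.
  by rewrite [(0 : tensor R I) i]ffunE conjC0 mulr0.
set s := tnorm X.
have s2 : s ^+ 2 = tdot X X by rewrite sqrtCK.
have s_ge0 : 0 <= s by rewrite sqrtC_ge0 tdot_ge0.
have sn0 : s != 0 by rewrite -sqrf_eq0 s2.
have sC : (s^-1)^* = s^-1 by rewrite geC0_conj // invr_ge0.
pose Y : tensor R I := [ffun i => s^-1 * X i].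
have AY : tdot (einstein_act A Y) Y = s^-2 * tdot (einstein_act A X) X.
  rewrite /tdot mulr_sumr; apply: eq_bigr => i _.
  rewrite !ffunE rmorphM /= sC.
  under eq_bigr do rewrite ffunE mulrCA.
  by rewrite -mulr_sumr; field.
have YY : tdot Y Y = s^-2 * tdot X X.
  rewrite /tdot mulr_sumr; apply: eq_bigr => i _.
  by rewrite !ffunE rmorphM /= sC; field.
have Y1 : tnorm Y = 1 by rewrite /tnorm YY -s2 mulVf ?sqrtC1 // s2.
have /numerical_radius_ge : numerical_range A (tdot (einstein_act A Y) Y).
  by exists Y.
have w1 : (numerical_radius A)%:C%C <= 1 :> R[i] by rewrite lecR.
move=> /le_trans /(_ w1); rewrite AY normrM normfV normrX (ger0_norm s_ge0) s2 ler_pdivrMl ?mulr1 //.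
by rewrite lt_def Xn0 tdot_ge0.
Qed.

Lemma tensor_abs_tdot A X : tensor_ge (tensor_abs A) idtensor ->
  tdot X X <= tdot (einstein_act A X) (einstein_act A X).
Proof.
rewrite /tensor_abs /tensor_sqrt; case: xgetP => [P _ [[Ph _] PP] [_ Q]|_ [_ Q]].
  (* As [P] is Hermitian with [P P = A^H A], [A X] and [P X] have the same norm. Then [P X = X + Y]
     with [<Y, X> >= 0]. *)
  rewrite tdot_adjoint -einstein_actM -PP einstein_actM -{1}Ph -tdot_adjoint.
  have := Q X; rewrite einstein_actBl einstein_act1.
  set Y := _ - X => YX.
  have PX : einstein_act P X = X + Y by rewrite addrC subrK.
  move: Y YX PX => Y YX ->; rewrite tdotDl !tdotDr -addrA lerDl (tdotC X Y).
  by rewrite !addr_ge0 ?conjC_ge0 ?tdot_ge0.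
(* If [xget] falls back to its default 0, the hypothesis says that [- idtensor] is positive
   semidefinite, so [<X, X> <= 0]. *)
have := Q X; rewrite einstein_actBl einstein_act1.
have -> : einstein_act 0 X = 0.
  by apply/ffunP => i; rewrite !ffunE big1 // => k _; rewrite ffunE mul0r.
rewrite sub0r => X_le0; apply: le_trans (tdot_ge0 _).
rewrite -oppr_ge0 (le_trans X_le0) // /tdot -sumrN.
by rewrite ler_sum // => i _; rewrite ffunE mulNr.
Qed.

End TensorAlgebra.

(** * Transfer between tensors and matrices *)

Section Flattening.
Local Open Scope sesquilinear_scope.
Variables (R : realType) (N : nat) (I : 'I_N -> nat).
Implicit Types (A B : sqtensor R I) (X Y : tensor R I).

Definition tensor_mx A : 'M[R[i]]_#|mindex I| :=
  \matrix_(i, j) A (enum_val i, enum_val j).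

(* [tdot] is linear in its first argument, so [X] is flattened to the row
   [X^H]: then [dotmx (X^H A) X^H] is [tdot (A X) X]. *)
Definition tensor_rv X : 'rV[R[i]]_#|mindex I| := \row_i (X (enum_val i))^*.

Definition rv_tensor (v : 'rV[R[i]]_#|mindex I|) : tensor R I :=
  [ffun i => (v 0 (enum_rank i))^*].

Lemma rv_tensorK : cancel rv_tensor tensor_rv.
Proof. by move=> v; apply/rowP => i; rewrite mxE ffunE enum_valK conjCK. Qed.

Lemma sum_enum_val (F : mindex I -> R[i]) :
  \sum_(i < #|mindex I|) F (enum_val i) = \sum_k F k.
Proof. by rewrite [RHS](reindex _ (onW_bij _ (@enum_val_bij _))). Qed.

Lemma tensor_mx_inj : injective tensor_mx.
Proof.
move=> A B /matrixP AB; apply/ffunP => -[i j].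
by have := AB (enum_rank i) (enum_rank j); rewrite !mxE !enum_rankK.
Qed.

Lemma tensor_mxM A B : tensor_mx (einstein A B) = tensor_mx A *m tensor_mx B.
Proof.
apply/matrixP => i j; rewrite !mxE ffunE /= -sum_enum_val.
by apply: eq_bigr => k _; rewrite !mxE.
Qed.

Lemma tensor_mx1 : tensor_mx idtensor = 1%:M.
Proof. by apply/matrixP => i j; rewrite !mxE idtensorE (inj_eq enum_val_inj). Qed.

Lemma tensor_mx_ctranspose A : tensor_mx (ctranspose A) = (tensor_mx A)^t*.
Proof. by apply/matrixP => i j; rewrite !mxE ffunE. Qed.

Lemma tensor_rv_act A X :
  tensor_rv (einstein_act A X) = tensor_rv X *m tensor_mx (ctranspose A).
Proof.
apply/rowP => i; rewrite !mxE ffunE rmorph_sum -sum_enum_val.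
by apply: eq_bigr => k _; rewrite !mxE ffunE /= rmorphM mulrC.
Qed.

Lemma dotmx_tensor_rv X Y : dotmx (tensor_rv X) (tensor_rv Y) = tdot Y X.
Proof.
rewrite dotmx_sumE /tdot -sum_enum_val; apply: eq_bigr => i _.
by rewrite !mxE conjCK mulrC.
Qed.

End Flattening.

Theorem lemma4p6 (R : realType) (N : nat) (I : 'I_N -> nat)
    (I_gt0 : forall r : 'I_N, (0 < I r)%N) (A : sqtensor R I)
    (A_inv : invertible_tensor A)
    (wA_le1 : numerical_radius A <= 1)
    (absA_ge1 : tensor_ge (tensor_abs A) idtensor) :
  unitary_tensor A.
Proof.
have /unitarymxP Au : tensor_mx A \is unitarymx.
  apply: numerical_range_unitarymx => v; rewrite -(rv_tensorK v).
    (* Right multiplication of [X^H] by the matrix of [A] is the action of [A^H] on [X]. The form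
       becomes [<X, A^H X> = <A X, X>]. *)
    rewrite -[A in tensor_mx A]ctransposeK -tensor_rv_act !dotmx_tensor_rv.
    rewrite -tdot_adjoint; exact: numerical_radius_tdot.
  rewrite -tensor_mx_ctranspose -tensor_rv_act !dotmx_tensor_rv.
  exact: tensor_abs_tdot.
(* [unitarymxP] gives only [M M^H = 1]; for square matrices [mulmx1C] supplies the other order. *)
by split; apply: tensor_mx_inj;
  rewrite tensor_mxM tensor_mx1 tensor_mx_ctranspose // (mulmx1C Au).
Qed.
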